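(* Let $\mathbf r=(r^{0},r^1,r^2)$ be an integer vector with $r^2\ge-1$, $r^1\ge\max\{2r^2,-1\}$, $r^0\ge\max\{2r^1,-1\}$, and let $k\ge\max\{2r^0+1,0\}$ be an integer. On a tetrahedron $T$ the following geometric decomposition of the polynomial space holds: $$\mathbb P_k(T)=\bigoplus_{\ell=0}^3\ \bigoplus_{f\in\Delta_\ell(T)}\mathbb P_k(S_\ell(f,\mathbf r)).$$
   Context: $T$ is a tetrahedron with vertices indexed by $0,1,2,3$ and barycentric coordinates $\lambda_0,\dots,\lambda_3$; $\mathbb P_k(T)$ is the space of real polynomials of degree $\le k$ on $T$. $\Delta_\ell(T)$ is the set of $\ell$-dimensional subsimplices of $T$, and a subsimplex $f$ is identified with its set of vertex indices. $\mathbb T_k^3(T)=\{\alpha\in\mathbb N^4:|\alpha|=k\}$; $\lambda^\alpha=\prod\lambda_i^{\alpha_i}$; for $S\subseteq\mathbb T_k^3(T)$, $\mathbb P_k(S)=\operatorname{span}\{\lambda^\alpha:\alpha\in S\}$. $\operatorname{dist}(\alpha,f)=\sum_{i\notin f}\alpha_i$ and $D(f,r)=\{\alpha\in\mathbb T_k^3(T):\operatorname{dist}(\alpha,f)\le r\}$, so $D(f,-1)=\varnothing$. The sets $S_\ell$ are $S_0(\mathtt v,\mathbf r)=D(\mathtt v,r^0)$; $S_\ell(f,\mathbf r)=D(f,r^\ell)\setminus\bigcup_{i=0}^{\ell-1}\bigcup_{e\in\Delta_i(f)}D(e,r^i)$ for $\ell=1,2$; $S_3(T,\mathbf r)=\mathbb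 T_k^3(T)\setminus\bigcup_{i=0}^2\bigcup_{f\in\Delta_i(T)}D(f,r^i)$. *)

(* Defs.v *)
From HB Require Import structures.
From mathcomp Require Import all_boot all_order all_algebra reals.
From mathcomp Require Import mpoly.

Set Implicit Arguments.
Unset Strict Implicit.
Unset Printing Implicit Defensive.

Import Order.TTheory GRing.Theory Num.Theory.
Local Open Scope ring_scope.

(* U is the internal direct sum of the W i, for i satisfying P: U is the set of
   all sums of elements of the W i, and such sums have unique components. *)
Definition is_direct_sum (V : nmodType) (I : finType) (P : pred I)
    (U : V -> Prop) (W : I -> V -> Prop) : Prop :=
  (forall u : V, U u <->
     exists w : I -> V,
       (forall i, P i -> W i (w i)) /\ u = \sum_(i | P i) w i) /\
  (forall w w' : I -> V,
     (forall i, P i -> W i (w i)) -> (forall i, P i -> W i (w' i)) ->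
     \sum_(i | P i) w i = \sum_(i | P i) w' i ->
     forall i, P i -> w i = w' i).

Section Geometry.

Variable R : realType.

Definition affinely_independent (n m : nat) (v : 'I_m -> 'rV[R]_n) : Prop :=
  forall c : 'I_m -> R,
    \sum_i c i = 0 -> \sum_i c i *: v i = 0 -> forall i, c i = 0.

(* A polynomial on a tetrahedron, which has nonempty interior in R^3, is
   identified with a polynomial in the three Cartesian coordinates. *)
Definition polys_of_degree_le (k : nat) (p : {mpoly R[3]}) : Prop :=
  (msize p <= k.+1)%N.

Variable v : 'I_4 -> 'rV[R]_3.

(* The i-th row is (1, v i). *)
Definition vertex_mx : 'M[R]_4 :=
  row_mx (const_mx 1 : 'cV[R]_4) (\matrix_i v i).

Definition affine_coords : 'rV[{mpoly R[3]}]_4 :=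
  row_mx (const_mx 1 : 'rV_1) (\row_(j < 3) 'X_j).

(* Solution of \sum_i lambda_i = 1, \sum_i lambda_i v_i = x; see
   sum_barycentric and barycentric_vertices. *)
Definition barycentric (i : 'I_4) : {mpoly R[3]} :=
  (affine_coords *m map_mx (@mpolyC 3 R) (invmx vertex_mx)) 0 i.

Definition barycentric_monomial (a : 'X_{1..4}) : {mpoly R[3]} :=
  \prod_(i < 4) barycentric i ^+ a i.

Definition span_monomials (k : nat) (S : {set 'X_{1..4 < k.+1}})
    (p : {mpoly R[3]}) : Prop :=
  exists c : 'X_{1..4 < k.+1} -> R,
    p = \sum_(a in S) c a *: barycentric_monomial a.

Lemma vertex_mx_unit : affinely_independent v -> vertex_mx \in unitmx.
Proof.
move=> v_indep; rewrite -row_free_unit -kermx_eq0.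
apply/rowV0P => u /sub_kermxP uA0.
have /eq_row_mx[u1 uv] : row_mx (u *m (const_mx 1 : 'cV_4)) (u *m \matrix_i v i)
    = row_mx 0 0 by rewrite -mul_mx_row row_mx0.
apply/rowP => i; rewrite mxE; apply: (v_indep (u 0)) i.
  transitivity ((u *m (const_mx 1 : 'cV_4)) 0 0); last by rewrite u1 mxE.
  by rewrite mxE; apply: eq_bigr => j _; rewrite mxE mulr1.
by rewrite -[RHS]uv mulmx_sum_row; apply: eq_bigr => i _; rewrite rowK.
Qed.

Lemma mul_barycentric : affinely_independent v ->
  (\row_i barycentric i) *m map_mx (@mpolyC 3 R) vertex_mx = affine_coords.
Proof.
move=> /vertex_mx_unit vU.
have -> : \row_i barycentric i =
    affine_coords *m map_mx (@mpolyC 3 R) (invmx vertex_mx).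
  by apply/rowP => i; rewrite mxE.
by rewrite -mulmxA -map_mxM mulVmx // map_mx1 mulmx1.
Qed.

Lemma sum_barycentric : affinely_independent v -> \sum_i barycentric i = 1.
Proof.
move=> /mul_barycentric /matrixP/(_ 0 (lshift 3 (0 : 'I_1))).
rewrite mxE (row_mxEl (const_mx 1 : 'rV_1)) mxE => <-.
apply: eq_bigr => i _; rewrite mxE mxE.
by rewrite (row_mxEl (const_mx 1 : 'cV_4)) mxE mpolyC1 mulr1.
Qed.

Lemma barycentric_vertices (j : 'I_3) : affinely_independent v ->
  \sum_i v i 0 j *: barycentric i = 'X_j.
Proof.
move=> /mul_barycentric /matrixP/(_ 0 (rshift 1 j)).
rewrite mxE (row_mxEr (const_mx 1 : 'rV_1)) mxE => <-.
apply: eq_bigr => i _; rewrite mxE mxE.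
by rewrite (row_mxEr (const_mx 1 : 'cV_4)) !mxE mulrC mul_mpolyC.
Qed.

End Geometry.

Section Lattice.

(* A subsimplex of T is represented by its set of vertex indices, T itself by
   [set: 'I_4]. The multi-indices alpha with |alpha| = k live in the finite type
   'X_{1..4 < k.+1} of those with |alpha| <= k. *)

Definition subsimplices (l : nat) (f : {set 'I_4}) : {set {set 'I_4}} :=
  [set e : {set 'I_4} | e \subset f & #|e| == l.+1].

Variable k : nat.

Definition simplicial_lattice : {set 'X_{1..4 < k.+1}} :=
  [set a : 'X_{1..4 < k.+1} | mdeg a == k].

Definition lattice_dist (a : 'X_{1..4}) (f : {set 'I_4}) : nat :=
  (\sum_(i < 4 | i \notin f) a i)%N.

Definition lattice_tube (f : {set 'I_4}) (r : int) : {set 'X_{1..4 < k.+1}} :=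
  [set a in simplicial_lattice | (lattice_dist a f)%:Z <= r].

(* For l = 0 the union is empty, so that S_0(v, r) = D(v, r^0). *)
Definition lattice_piece (r : 3.-tuple int) (l : nat) (f : {set 'I_4}) :
    {set 'X_{1..4 < k.+1}} :=
  (if (l < 3)%N then lattice_tube f r`_l else simplicial_lattice)
  :\: \bigcup_(i < l) \bigcup_(e in subsimplices i f) lattice_tube e r`_i.

End Lattice.

(* Main.v *)
Require Import Defs.
From HB Require Import structures.
From mathcomp Require Import all_boot all_order all_algebra reals.
From mathcomp Require Import mpoly zify.
Import Order.TTheory GRing.Theory Num.Theory.
Local Open Scope ring_scope.

Set Implicit Arguments.
Unset Strict Implicit.
Unset Printing Implicit Defensive.

(* The monomials lambda^alpha with |alpha| = k are a basis of P_k(T), and the sets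
   S_l(f, r) partition the indices alpha, so the spans decompose P_k(T).

   Basis: the lambda_i are linearly independent linear forms in the homogeneous
   coordinates (1, x_0, x_1, x_2). A linear change of variables permutes the
   forms of degree k, and setting the first variable to 1 maps these bijectively
   onto the polynomials of degree <= k.

   Partition: alpha lies in S_l(f, r) for l the least dimension such that alpha is
   in some D(f, r^l), dim f = l. For uniqueness, let alpha be in D(e, r^l) and in
   D(f, r^m) with l <= m < 3 and e not contained in f. Then e :&: f has dimension
   i < l and dist(alpha, e :&: f) <= r^l + r^m <= 2 r^l. If e :&: f is empty this
   distance is k, which exceeds 2 r^0; otherwise it is <= r^i, and alpha was
   already removed from S_m(f, r). *)

(** * Substitution into multivariate polynomials *)

Lemma comp_mpolyA (R : comNzRingType) (n m l : nat) (p : {mpoly R[n]})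
    (t : n.-tuple {mpoly R[m]}) (u : m.-tuple {mpoly R[l]}) :
  (p \mPo t) \mPo u = p \mPo [tuple tnth t i \mPo u | i < n].
Proof.
rewrite !(comp_mpolyE p) raddf_sum; apply: eq_bigr => a _ /=.
rewrite comp_mpolyZ rmorph_prod; congr (_ *: _).
by apply: eq_bigr => i _; rewrite rmorphXn tnth_mktuple.
Qed.

(** A monomial of degree [k] turns into a product of [k] forms of degree 1. *)
Lemma dhomog_comp (R : comNzRingType) (n m k : nat) (p : {mpoly R[n]})
    (t : n.-tuple {mpoly R[m]}) :
  p \is k.-homog -> (forall i, tnth t i \is 1.-homog) -> p \mPo t \is k.-homog.
Proof.
move=> /dhomogP p_hom t_hom; rewrite comp_mpolyE big_seq.
apply: rpred_sum => a /p_hom /= <-; apply: rpredZ.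
rewrite mdegE; pose d := [tuple a i | i < n].
pose s := [tuple tnth t i ^+ a i | i < n].
have -> : (\sum_i a i = \sum_(e <- d) e)%N.
  by rewrite big_tuple; apply: eq_bigr => i _; rewrite tnth_mktuple.
have -> : \prod_i tnth t i ^+ a i = \prod_(q <- s) q.
  by rewrite big_tuple; apply: eq_bigr => i _; rewrite tnth_mktuple.
apply: dhomog_prod => i; rewrite !tnth_mktuple.
by have := dhomogMn (a i) (t_hom i); rewrite mul1n.
Qed.

(** * Homogenization and dehomogenization *)

Section Homogenization.

Variables (R : comNzRingType) (n : nat).

(** Dehomogenization. Variable 0 is the homogenizing one, in agreement with the column of ones in
    [vertex_mx]. *)
Definition affine_chart : n.+1.-tuple {mpoly R[n]} :=
  [tuple oapp (fun j => 'X_j) 1 (unlift ord0 i) | i < n.+1].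

Definition drop_first (a : 'X_{1..n.+1}) : 'X_{1..n} :=
  [multinom a (lift ord0 i) | i < n].

(** Exponent of the homogenized monomial. The subtraction truncates, so the total degree is [k] only
    when [mdeg a <= k]. *)
Definition complete_degree (k : nat) (a : 'X_{1..n}) : 'X_{1..n.+1} :=
  [multinom oapp a (k - mdeg a)%N (unlift ord0 i) | i < n.+1].

Lemma mdeg_drop_first a : mdeg a = (a ord0 + mdeg (drop_first a))%N.
Proof.
by rewrite !mdegE big_ord_recl; congr addn; apply: eq_bigr => i _; rewrite mnmE.
Qed.

Lemma drop_first_inj a b :
  mdeg a = mdeg b -> drop_first a = drop_first b -> a = b.
Proof.
move=> eq_deg eq_drop; apply/mnmP => i.
case: (unliftP ord0 i) => [j ->|->].
  by have /mnmP/(_ j) := eq_drop; rewrite !mnmE.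
by move: eq_deg; rewrite !mdeg_drop_first eq_drop => /addIn.
Qed.

Lemma complete_degreeK k : cancel (complete_degree k) drop_first.
Proof. by move=> a; apply/mnmP => i; rewrite !mnmE liftK. Qed.

Lemma mdeg_complete_degree k a :
  (mdeg a <= k)%N -> mdeg (complete_degree k a) = k.
Proof.
move=> le_ak.
by rewrite mdeg_drop_first complete_degreeK mnmE unlift_none /= subnK.
Qed.

Lemma comp_affine_chartX a :
  'X_[a] \mPo affine_chart = 'X_[drop_first a].
Proof.
rewrite comp_mpolyX big_ord_recl tnth_mktuple unlift_none /= expr1n mul1r.
rewrite [RHS]mpolyXE_id; apply: eq_bigr => i _.
by rewrite tnth_mktuple liftK mnmE.
Qed.

(** In a fixed degree the exponent of variable 0 is determined by the others, so dehomogenizing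
    merges no two monomials of [p]. *)
Lemma mcoeff_comp_affine_chart k (p : {mpoly R[n.+1]}) a :
  p \is k.-homog -> mdeg a = k ->
  (p \mPo affine_chart)@_(drop_first a) = p@_a.
Proof.
move=> /dhomogP p_hom a_deg; rewrite comp_mpolyEX [in RHS](mpolyE p) !raddf_sum /=.
rewrite !big_seq; apply: eq_bigr => b /p_hom /= b_deg.
rewrite comp_affine_chartX !mcoeffZ !mcoeffX; congr (_ * (_ : bool)%:R).
apply/eqP/eqP => [|->//]; apply: drop_first_inj; by rewrite b_deg.
Qed.

Lemma comp_affine_chart_eq0 k (p : {mpoly R[n.+1]}) :
  p \is k.-homog -> p \mPo affine_chart = 0 -> p = 0.
Proof.
move=> p_hom p0; apply/mpolyP => a; rewrite mcoeff0.
have [a_deg|] := eqVneq (mdeg a) k; last exact: dhomog_nemf_coeff.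
by rewrite -(mcoeff_comp_affine_chart p_hom a_deg) p0 mcoeff0.
Qed.

Lemma homogenization k (u : {mpoly R[n]}) : (msize u <= k.+1)%N ->
  exists2 p : {mpoly R[n.+1]}, p \is k.-homog & p \mPo affine_chart = u.
Proof.
move=> u_deg.
exists (\sum_(a <- msupp u) u@_a *: 'X_[complete_degree k a]).
  rewrite big_seq; apply: rpred_sum => a /msize_mdeg_lt a_lt.
  apply: rpredZ; rewrite dhomogX /= mdeg_complete_degree //.
  by rewrite -ltnS (leq_trans a_lt).
rewrite [RHS]mpolyE raddf_sum; apply: eq_bigr => a _ /=.
by rewrite comp_mpolyZ comp_affine_chartX complete_degreeK.
Qed.

Lemma msize_comp_affine_chart k (p : {mpoly R[n.+1]}) :
  p \is k.-homog -> (msize (p \mPo affine_chart) <= k.+1)%N.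
Proof.
move=> /dhomogP p_hom; rewrite comp_mpolyEX big_seq.
apply: (big_ind (fun q => msize q <= k.+1)%N) => [|q s q_le s_le|a /p_hom /= a_deg].
- by rewrite msize0.
- by rewrite (leq_trans (msizeD_le _ _)) // geq_max q_le.
- rewrite comp_affine_chartX (leq_trans (msizeZ_le _ _)) // msizeX ltnS.
  by rewrite -a_deg mdeg_drop_first leq_addl.
Qed.

End Homogenization.

(** * Linear changes of variables *)

Definition linear_forms (R : comNzRingType) (n : nat) (A : 'M[R]_n) :
    n.-tuple {mpoly R[n]} :=
  [tuple \sum_j A j i *: 'X_j | i < n].

Lemma dhomog_linear_forms (R : comNzRingType) (n : nat) (A : 'M[R]_n) i :
  tnth (linear_forms A) i \is 1.-homog.
Proof.
rewrite tnth_mktuple; apply: rpred_sum => j _.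
by apply: rpredZ; rewrite dhomogX /= mdeg1.
Qed.

Lemma comp_linear_formsK (R : comNzRingType) (n : nat) (A B : 'M[R]_n) p :
  B *m A = 1%:M -> (p \mPo linear_forms A) \mPo linear_forms B = p.
Proof.
move=> BA1; rewrite comp_mpolyA -[RHS]comp_mpoly_id.
congr (_ \mPo _); apply: eq_from_tnth => i; rewrite !tnth_mktuple raddf_sum /=.
transitivity (\sum_j \sum_l (B l j * A j i) *: 'X_l : {mpoly R[n]}).
  apply: eq_bigr => j _.
  rewrite comp_mpolyZ comp_mpolyXU -tnth_nth tnth_mktuple scaler_sumr.
  by apply: eq_bigr => l _; rewrite scalerA mulrC.
(* The coefficient of ['X_l] is the entry [(l, i)] of [B *m A], a Kronecker delta. *)
rewrite exchange_big /= (bigD1 i) //= [X in _ + X]big1 ?addr0 => [|l l_i].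
  rewrite -scaler_suml; have /matrixP/(_ i i) := BA1.
  by rewrite !mxE eqxx => ->; rewrite scale1r.
rewrite -scaler_suml; have /matrixP/(_ l i) := BA1.
by rewrite !mxE (negPf l_i) => ->; rewrite scale0r.
Qed.

(** * The barycentric monomials of degree [k] as a basis *)

Section BarycentricBasis.

Variables (R : realType) (v : 'I_4 -> 'rV[R]_3).
Hypothesis v_indep : affinely_independent v.

Let forms := linear_forms (invmx (vertex_mx v)).

Lemma barycentricE i : barycentric v i = tnth forms i \mPo affine_chart R 3.
Proof.
rewrite /barycentric mxE tnth_mktuple raddf_sum /=; apply: eq_bigr => j _.
rewrite [map_mx _ _ _ _]mxE comp_mpolyZ comp_mpolyXU -tnth_nth tnth_mktuple.
rewrite mulrC mul_mpolyC; congr (_ *: _); rewrite /affine_coords.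
case: (unliftP ord0 j) => [l ->|->] /=.
  have -> : lift ord0 l = rshift 1 (l : 'I_3) by exact: val_inj.
  by rewrite (row_mxEr (const_mx 1 : 'rV_1)) mxE.
have -> : (ord0 : 'I_4) = lshift 3 (ord0 : 'I_1) by apply: val_inj.
by rewrite (row_mxEl (const_mx 1 : 'rV_1)) mxE.
Qed.

Lemma barycentric_monomialE a :
  barycentric_monomial v a = ('X_[a] \mPo forms) \mPo affine_chart R 3.
Proof.
rewrite comp_mpolyA comp_mpolyX; apply: eq_bigr => i _.
by rewrite tnth_mktuple barycentricE.
Qed.

Lemma sum_barycentric_monomialE k (S : {set 'X_{1..4 < k.+1}}) (c : _ -> R) :
  \sum_(a in S) c a *: barycentric_monomial v a =
  ((\sum_(a in S) c a *: 'X_[a]) \mPo forms) \mPo affine_chart R 3.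
Proof.
rewrite (raddf_sum (comp_mpoly forms)) raddf_sum; apply: eq_bigr => a _ /=.
by rewrite barycentric_monomialE !comp_mpolyZ.
Qed.

Lemma span_barycentric_monomialsP k u :
  span_monomials v (simplicial_lattice k) u <-> polys_of_degree_le k u.
Proof.
split=> [[c ->]|u_deg].
  rewrite sum_barycentric_monomialE.
  apply: msize_comp_affine_chart; apply: dhomog_comp (dhomog_linear_forms _).
  apply: rpred_sum => a; rewrite inE => /eqP a_deg.
  by apply: rpredZ; rewrite dhomogX /= a_deg.
have [q q_hom <-] := homogenization u_deg.
(* [p] is the form [q] rewritten in the variables lambda, so its coefficients are those of [u] in
   the monomials lambda^alpha. *)
pose p := q \mPo linear_forms (vertex_mx v).
have p_hom : p \is k.-homog := dhomog_comp q_hom (dhomog_linear_forms _).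
have -> : q = p \mPo forms.
  by rewrite comp_linear_formsK // mulVmx // vertex_mx_unit.
exists (fun a => p@_a); rewrite sum_barycentric_monomialE.
(* [p] is expanded over all multi-indices of degree at most [k]; by homogeneity those of degree
   below [k] contribute nothing. *)
congr ((_ \mPo _) \mPo _); rewrite [LHS](mpolywE (k := k.+1)); last first.
  rewrite msizeE; apply/bigmax_leqP_seq => a a_p _.
  by rewrite (dhomog_mf p_hom a_p).
rewrite (bigID (mem (simplicial_lattice k))) /= [X in _ + X]big1 ?addr0 // => a.
by rewrite inE => a_deg; rewrite (dhomog_nemf_coeff p_hom) ?scale0r.
Qed.

(** Dehomogenization is injective on forms of degree [k], and the linear change of variables is
    invertible. *)
Lemma barycentric_monomials_free k (c : 'X_{1..4 < k.+1} -> R) :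
  \sum_(a in simplicial_lattice k) c a *: barycentric_monomial v a = 0 ->
  {in simplicial_lattice k, forall a, c a = 0}.
Proof.
move=> sum0 a a_k.
pose p : {mpoly R[4]} := \sum_(b in simplicial_lattice k) c b *: 'X_[b].
have p_hom : p \is k.-homog.
  apply: rpred_sum => b; rewrite inE => /eqP b_deg.
  by apply: rpredZ; rewrite dhomogX /= b_deg.
have p0 : p \mPo forms = 0.
  apply: (comp_affine_chart_eq0 (k := k)).
    exact: dhomog_comp (dhomog_linear_forms _).
  by rewrite -[RHS]sum0 sum_barycentric_monomialE.
have /(congr1 (mcoeff a)) : p = 0.
  rewrite -[LHS](@comp_linear_formsK _ _ (invmx (vertex_mx v)) (vertex_mx v)).
    by rewrite -/forms p0 comp_mpoly0.
  by rewrite mulmxV // vertex_mx_unit.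
rewrite mcoeff0 raddf_sum (bigD1 a) //= mcoeffZ mcoeffX eqxx mulr1.
rewrite big1 ?addr0 // => b /andP[_ b_a].
by rewrite mcoeffZ mcoeffX (inj_eq val_inj) (negPf b_a) mulr0.
Qed.

End BarycentricBasis.

(** * Direct sums from a partition of a free family *)

Section DirectSum.

Variables (R : pzRingType) (V : lmodType R) (I T : finType).
Variables (P : pred I) (B : {set T}) (b : T -> V) (S : I -> {set T}).

(** After exchanging the sums, the inner one runs over the single [i] whose [S i] contains [a]. *)
Lemma big_cover (A : nmodType) (F : T -> A) :
  (forall i, P i -> S i \subset B) ->
  (forall a, a \in B -> exists i, P i && (a \in S i)) ->
  (forall i j a, P i -> P j -> a \in S i -> a \in S j -> i = j) ->
  \sum_(a in B) F a = \sum_(i | P i) \sum_(a in S i) F a.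
Proof.
move=> S_sub S_cover S_disj.
rewrite (exchange_big_dep (mem B)) /= => [|i a Pi a_i]; last first.
  exact: (subsetP (S_sub i Pi)).
apply: eq_bigr => a /S_cover[i /andP[Pi a_i]].
rewrite (big_pred1 i) // => j; apply/andP/eqP => [[Pj a_j]|->//].
exact: S_disj a_j a_i.
Qed.

Lemma is_direct_sum_span :
  (forall i, P i -> S i \subset B) ->
  (forall a, a \in B -> exists i, P i && (a \in S i)) ->
  (forall i j a, P i -> P j -> a \in S i -> a \in S j -> i = j) ->
  (forall c : T -> R, \sum_(a in B) c a *: b a = 0 ->
     {in B, forall a, c a = 0}) ->
  is_direct_sum P (fun u => exists c : T -> R, u = \sum_(a in B) c a *: b a)
    (fun i u => exists c : T -> R, u = \sum_(a in S i) c a *: b a).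
Proof.
move=> S_sub S_cover S_disj b_free.
(* Disjointness makes the picked index the only one possible; outside all pieces the value defaults
   to 0. *)
have glue (c : I -> T -> R) : exists d : T -> R,
    forall i, P i -> {in S i, forall a, d a = c i a}.
  exists (fun a => oapp (c^~ a) 0 [pick i | P i && (a \in S i)]) => i Pi a a_i.
  case: pickP => [j /andP[Pj a_j]|/(_ i)]; last by rewrite Pi a_i.
  by rewrite (S_disj j i a).
have components w : (forall i, P i -> exists c : T -> R,
      w i = \sum_(a in S i) c a *: b a) ->
    exists d : T -> R, forall i, P i -> w i = \sum_(a in S i) d a *: b a.
  move=> w_span.
  (* Finite choice needs a witness for every [i]; where [P i] fails, the zero function serves. *)
  have /fin_all_exists[c w_c] : forall i, exists c : T -> R,
      P i -> w i = \sum_(a in S i) c a *: b a.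
    move=> i; have [/w_span[c ->]|_] := boolP (P i); first by exists c.
    by exists (fun=> 0).
  have [d d_c] := glue c; exists d => i Pi; rewrite w_c //.
  by apply: eq_bigr => a a_i; rewrite (d_c i).
split=> [u|w w' w_span w'_span eq_sum i Pi].
  split=> [[c ->]|[w [/components[d w_d] ->]]].
    exists (fun i => \sum_(a in S i) c a *: b a).
    by split=> [i _|]; [exists c | exact: big_cover].
  by exists d; rewrite big_cover //; apply: eq_bigr => i Pi; exact: w_d.
have [[d w_d] [d' w'_d']] := (components w w_span, components w' w'_span).
rewrite w_d // w'_d' //; apply: eq_bigr => a a_i; congr (_ *: _).
apply/eqP; rewrite -subr_eq0; apply/eqP.
apply: (b_free (fun a => d a - d' a)); last exact: subsetP (S_sub i Pi) _ a_i.
under eq_bigr do rewrite scalerBl.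
rewrite sumrB !big_cover // -(eq_bigr _ w_d) -(eq_bigr _ w'_d') eq_sum.
exact: subrr.
Qed.

End DirectSum.

(** * The partition of the simplicial lattice *)

Section LatticePartition.

Lemma lattice_dist0 a : lattice_dist a set0 = mdeg a.
Proof. by rewrite mdegE; apply: eq_bigl => i; rewrite inE. Qed.

(** A vertex outside [e :&: f] is outside [e] or outside [f], so its exponent is counted on the
    right. *)
Lemma lattice_distI a (e f : {set 'I_4}) :
  (lattice_dist a (e :&: f) <= lattice_dist a e + lattice_dist a f)%N.
Proof.
rewrite /lattice_dist !(big_mkcond (fun i => i \notin _)) -big_split /=.
apply: leq_sum => i _; rewrite inE.
by case: (i \in e); case: (i \in f); rewrite /= ?addn0 ?add0n ?leq_addr.
Qed.

Variables (k : nat) (r : 3.-tuple int).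
Hypotheses (hr2 : -1 <= r`_2) (hr1 : Num.max (2 * r`_2) (-1) <= r`_1).
Hypotheses (hr0 : Num.max (2 * r`_1) (-1) <= r`_0).
Hypothesis hk : Num.max (2 * r`_0 + 1) 0 <= k%:Z.

Let faces (l : 'I_4) := subsimplices l [set: 'I_4].

Lemma in_faces l f : (f \in faces l) = (#|f| == l.+1).
Proof. by rewrite inE subsetT. Qed.

Lemma in_lattice_tube f s a :
  (a \in @lattice_tube k f s) = (mdeg a == k) && ((lattice_dist a f)%:Z <= s).
Proof. by rewrite !inE. Qed.

Lemma lattice_piece_cover a : a \in simplicial_lattice k ->
  exists lf : 'I_4 * {set 'I_4},
    (lf.2 \in faces lf.1) && (a \in lattice_piece k r lf.1 lf.2).
Proof.
move=> a_k.
(* Dimension 3 is near without a tube condition, since S_3 starts from the whole lattice; hence a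
   least near dimension exists. *)
pose near l := (l == 3%N) || [exists e in subsimplices l [set: 'I_4],
   a \in lattice_tube k e r`_l].
have near3 : exists l, near l by exists 3%N.
have [l near_l l_min] := ex_minnP near3.
have l_lt : (l < 4)%N by rewrite ltnS l_min.
have not_lower f : a \notin
    \bigcup_(i < l) \bigcup_(e in subsimplices i f) lattice_tube k e r`_i.
  apply/bigcupP => -[i _ /bigcupP[e]]; rewrite inE => /andP[_ e_i] a_e.
  have /l_min : near i.
    by apply/orP; right; apply/exists_inP; exists e; rewrite // inE subsetT.
  by rewrite leqNgt ltn_ord.
have [f f_l a_f] : exists2 f, f \in subsimplices l [set: 'I_4] &
    a \in (if (l < 3)%N then lattice_tube k f r`_l else simplicial_lattice k).
  case/orP: near_l => [/eqP ->|/exists_inP[f f_l a_f]].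
    by exists [set: 'I_4] => //; rewrite inE subxx cardsT card_ord.
  by exists f => //; case: ifP.
exists (Ordinal l_lt, f); rewrite f_l /=.
by rewrite /lattice_piece in_setD not_lower.
Qed.

(** As [d] is natural, the radii up to index [l] are nonnegative, so the bounds 2 r^{i+1} <= r^i
    chain down to r^0, and 2 r^0 < k. For [d] the distance to an intersection of faces, the first
    conclusion excludes an empty intersection and the second gives membership in a removed tube. *)
Lemma double_radius (l : nat) (d : nat) : (l < 3)%N -> d%:Z <= 2 * r`_l ->
  (d < k)%N /\ forall i, (i < l)%N -> d%:Z <= r`_i.
Proof.
move: hr2 hr1 hr0 hk; rewrite !ge_max => h2 /andP[h1 _] /andP[h0 _] /andP[h _].
clear hr2 hr1 hr0 hk.
case: l => [|[|[|//]]] _ hd; split; try lia.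
- by case=> [|//] _; lia.
- by case=> [|[|//]] _; lia.
Qed.

(** Doubling does not decrease a nonnegative radius, and a negative radius is -1, the lower bound of
    all radii. *)
Lemma radius_anti (l m : nat) : (l <= m < 3)%N -> r`_m <= r`_l.
Proof.
move: hr2 hr1 hr0; rewrite !ge_max => h2 /andP[h1 h1'] /andP[h0 h0'].
case: l m => [|[|[|l]]] [|[|[|m]]] //=; rewrite ?andbF // => _.
all: move: (r`_0) (r`_1) (r`_2) h2 h1 h1' h0 h0' => r0 r1 r2; lia.
Qed.

Lemma lattice_piece_disjoint_le (l m : 'I_4) (e f : {set 'I_4}) a :
  (l <= m)%N -> e \in faces l -> f \in faces m ->
  a \in lattice_piece k r l e -> a \in lattice_piece k r m f -> (l, e) = (m, f).
Proof.
move=> le_lm; rewrite !in_faces => /eqP e_l /eqP f_m a_e a_f.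
have a_k : mdeg a == k.
  by move: a_e; rewrite inE => /andP[_]; case: ifP; rewrite !inE // => _ /andP[].
have not_lower (g : {set 'I_4}) i :
    (i < m)%N -> g \subset f -> #|g| = i.+1 -> ~ (lattice_dist a g)%:Z <= r`_i.
  move=> i_m g_f g_i a_g; move: a_f; rewrite inE => /andP[/bigcupP upper _].
  apply: upper; exists (Ordinal i_m) => //; apply/bigcupP; exists g.
    by rewrite inE g_f g_i eqxx.
  by rewrite in_lattice_tube a_k.
(* If [e] lies in [f], then either the dimensions agree and [e = f], or the tube of [e] was removed
   from the piece of [f]. *)
have [e_f|e_nf] := boolP (e \subset f).
  move: le_lm; rewrite leq_eqVlt => /orP[/val_eqP/= lm|lt_lm].
    have -> : e = f by apply/eqP; rewrite eqEcard e_f e_l f_m lm leqnn.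
    by rewrite lm.
  case: (not_lower _ _ lt_lm e_f e_l).
  move: a_e; rewrite inE ifT; last by rewrite (leq_trans lt_lm) // -ltnS.
  by case/andP=> _; rewrite in_lattice_tube => /andP[].
(* [f] misses a vertex of [e], so it is not the whole tetrahedron and its piece lies in a tube. *)
have m_lt : (m < 3)%N.
  rewrite ltn_neqAle -ltnS ltn_ord andbT; apply: contraNneq e_nf => m3.
  suff -> : f = [set: 'I_4] by apply: subsetT.
  by apply/eqP; rewrite eqEcard subsetT cardsT card_ord f_m m3.
have l_lt : (l < 3)%N := leq_ltn_trans le_lm m_lt.
have de : (lattice_dist a e)%:Z <= r`_l.
  by move: a_e; rewrite inE l_lt in_lattice_tube => /and3P[].
have df : (lattice_dist a f)%:Z <= r`_l.
  apply: le_trans (radius_anti (m := m) _); last by rewrite le_lm.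
  by move: a_f; rewrite inE m_lt in_lattice_tube => /and3P[].
have dI : (lattice_dist a (e :&: f))%:Z <= 2 * r`_l.
  by have := lattice_distI a e f; lia.
have [dI_k dI_r] := double_radius l_lt dI.
(* A nonempty intersection with [i.+1] vertices has dimension [i]; for an empty one the distance is
   the full degree [k]. *)
case cardI: #|e :&: f| => [|i].
  move/eqP: cardI; rewrite cards_eq0 => /eqP I0.
  by move: dI_k; rewrite I0 lattice_dist0 (eqP a_k) ltnn.
(* Otherwise [e :&: f] would have as many vertices as [e], forcing [e] into [f]. *)
have i_l : (i < l)%N.
  rewrite -ltnS -cardI -e_l ltnNge; apply: contra e_nf => e_I.
  have /eqP <- : e :&: f == e by rewrite eqEcard subsetIl.
  exact: subsetIr.
case: (not_lower (e :&: f) i (leq_trans i_l le_lm)) => //; last exact: dI_r.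
exact: subsetIr.
Qed.

Lemma lattice_piece_disjoint (lf mg : 'I_4 * {set 'I_4}) a :
  lf.2 \in faces lf.1 -> mg.2 \in faces mg.1 ->
  a \in lattice_piece k r lf.1 lf.2 -> a \in lattice_piece k r mg.1 mg.2 ->
  lf = mg.
Proof.
case: lf mg => [l f] [m g] /= f_l g_m a_f a_g; case/orP: (leq_total l m) => le.
  exact: lattice_piece_disjoint_le a_f a_g.
by apply/esym; apply: lattice_piece_disjoint_le a_g a_f.
Qed.

End LatticePartition.

Lemma lattice_piece_sub k (r : 3.-tuple int) l f :
  lattice_piece k r l f \subset simplicial_lattice k.
Proof.
apply: subset_trans (subsetDl _ _) _; case: ifP => // _.
by apply/subsetP => a; rewrite inE => /andP[].
Qed.

Theorem corollary3p5 (R : realType) (v : 'I_4 -> 'rV[R]_3)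
    (r : 3.-tuple int) (k : nat)
    (v_indep : affinely_independent v)
    (hr2 : -1 <= r`_2)
    (hr1 : Num.max (2 * r`_2) (-1) <= r`_1)
    (hr0 : Num.max (2 * r`_1) (-1) <= r`_0)
    (hk : Num.max (2 * r`_0 + 1) 0 <= k%:Z) :
  is_direct_sum
    (fun lf : 'I_4 * {set 'I_4} => lf.2 \in subsimplices lf.1 [set: 'I_4])
    (polys_of_degree_le k)
    (fun lf => span_monomials v (lattice_piece k r lf.1 lf.2)).
Proof.
have [spanP w_uniq] := is_direct_sum_span
  (fun (lf : 'I_4 * {set 'I_4}) _ => lattice_piece_sub k r lf.1 lf.2)
  (lattice_piece_cover r)
  (lattice_piece_disjoint hr2 hr1 hr0 hk)
  (barycentric_monomials_free v_indep (k := k)).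
split=> [u|]; last exact: w_uniq.
(* The decomposition obtained is that of the span of all monomials of degree [k], which is
   P_k(T). *)
exact: iff_trans (iff_sym (span_barycentric_monomialsP v_indep k u)) (spanP u).
Qed.
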